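(* Let $f,\mathcal{X},\mathcal{Y},A,B,\mathbf{c}$ satisfy the standing assumptions (a), (b), (c) listed in the context. Then the optimal values of the four problems (mM-I), (Mm-I), (mM-O), (Mm-O) satisfy \begin{itemize} \item $v(\text{mM-I}) \le v(\text{mM-O})$; \item $v(\text{Mm-I}) \ge v(\text{Mm-O})$; \item $v(\text{mM-O}) \ge v(\text{Mm-O})$. \end{itemize} Moreover, there is no definitive relation for the remaining pairs: for each of the three pairs $\{v(\text{mM-I}), v(\text{Mm-I})\}$, $\{v(\text{mM-I}), v(\text{Mm-O})\}$, $\{v(\text{mM-O}), v(\text{Mm-I})\}$, any of the relations $<$, $=$, $>$ can hold between its two members (i.e., for each pair and each of the three relations there is a problem instance in which that relation holds).
   Context: Data: $f:\mathbb{R}^n\times\mathbb{R}^m\to\mathbb{R}$, $\mathcal{X}\subseteq\mathbb{R}^n$, $\mathcal{Y}\subseteq\mathbb{R}^m$, $A\in\mathbb{R}^{k\times n}$, $B\in\mathbb{R}^{k\times m}$, $\mathbf{c}\in\mathbb{R}^k$; vector inequalities are componentwise. The four problems are: (mM-I): $\min_{\mathbf{x}\in\mathcal{X}}\big(\max_{\mathbf{y}\in\mathcal{Y},\,A\mathbf{x}+B\mathbf{y}\le\mathbf{c}} f(\mathbf{x},\mathbf{y})\big)$. (Mm-I): $\max_{\mathbf{y}\in\mathcal{Y}}\big(\min_{\mathbf{x}\in\mathcal{X},\,A\mathbf{x}+B\mathbf{y}\le\mathbf{c}} f(\mathbf{x},\mathbf{y})\big)$. (mM-O): $\min_{\mathbf{x}\in\mathcal{X},\,A\mathbf{x}+B\mathbf{y}^*(\mathbf{x})\le\mathbf{c}}\big(\max_{\mathbf{y}\in\mathcal{Y}}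 f(\mathbf{x},\mathbf{y})\big)$, where $\mathbf{y}^*(\mathbf{x})\in\arg\max_{\mathbf{y}\in\mathcal{Y}} f(\mathbf{x},\mathbf{y})$; a point $\mathbf{x}\in\mathcal{X}$ is feasible if $A\mathbf{x}+B\mathbf{y}^*(\mathbf{x})\le\mathbf{c}$ holds for at least one such maximizer. (Mm-O): $\max_{\mathbf{y}\in\mathcal{Y},\,A\mathbf{x}^*(\mathbf{y})+B\mathbf{y}\le\mathbf{c}}\big(\min_{\mathbf{x}\in\mathcal{X}} f(\mathbf{x},\mathbf{y})\big)$, where $\mathbf{x}^*(\mathbf{y})\in\arg\min_{\mathbf{x}\in\mathcal{X}} f(\mathbf{x},\mathbf{y})$; a point $\mathbf{y}\in\mathcal{Y}$ is feasible if $A\mathbf{x}^*(\mathbf{y})+B\mathbf{y}\le\mathbf{c}$ holds for at least one such minimizer. $v(P)$ denotes the optimal objective value of problem $P$ (min and max are read as inf and sup if not attained). Standing assumptions: (a) $f$ is continuous in $(\mathbf{x},\mathbf{y})$. (b) $\mathcal{X},\mathcal{Y}$ are convex and compact, with $\|\mathbf{x}\|\le D$ for all $\mathbf{x}\in\mathcal{X}$ and $\|\mathbf{y}\|\le D$ for all $\mathbf{y}\in\mathcal{Y}$, for some constant $D>0$. (c) Feasibility: for every $\mathbf{x}\in\mathcal{X}$ there is $\mathbf{y}\in\mathcal{Y}$ with $A\mathbf{x}+B\mathbf{y}\le\mathbf{c}$; for every $\mathbf{y}\in\mathcal{Y}$ there is $\mathbf{x}\in\mathcal{X}$ with $A\mathbf{x}+B\mathbf{y}\le\mathbf{c}$;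 (mM-O) and (Mm-O) each have at least one feasible point in the sense above. *)

(* Defs.v *)
From HB Require Import structures.
From mathcomp Require Import all_boot all_order all_algebra.
From mathcomp Require Import all_classical all_reals all_analysis.

Set Implicit Arguments.
Unset Strict Implicit.
Unset Printing Implicit Defensive.

Import Order.TTheory GRing.Theory Num.Theory.
Import numFieldNormedType.Exports.

Local Open Scope classical_set_scope.
Local Open Scope ring_scope.

(* The library norm `|x| on 'cV[R]_n is the sup norm, hence this definition. *)
Definition euclidean_norm (R : realType) (n : nat) (x : 'cV[R]_n) : R :=
  Num.sqrt (\sum_(i < n) x i 0 ^+ 2).

Definition le_vec (R : realType) (k : nat) (u v : 'cV[R]_k) : Prop :=
  forall i : 'I_k, u i 0 <= v i 0.

Record problem (R : realType) (n m k : nat) := Problem {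
  obj : 'cV[R]_n -> 'cV[R]_m -> R;
  setX : set 'cV[R]_n;
  setY : set 'cV[R]_m;
  matA : 'M[R]_(k, n);
  matB : 'M[R]_(k, m);
  vecc : 'cV[R]_k }.

Section Problems.
Context {R : realType} {n m k : nat}.
Variable P : problem R n m k.

Local Notation f := (obj P).
Local Notation X := (setX P).
Local Notation Y := (setY P).

Definition coupled (x : 'cV[R]_n) (y : 'cV[R]_m) : Prop :=
  le_vec (matA P *m x + matB P *m y) (vecc P).

Definition argmaxY (x : 'cV[R]_n) : set 'cV[R]_m :=
  [set y | Y y /\ forall y', Y y' -> f x y' <= f x y].

Definition argminX (y : 'cV[R]_m) : set 'cV[R]_n :=
  [set x | X x /\ forall x', X x' -> f x y <= f x' y].

Definition feasible_mMO : set 'cV[R]_n :=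
  [set x | X x /\ exists2 y, argmaxY x y & coupled x y].

Definition feasible_MmO : set 'cV[R]_m :=
  [set y | Y y /\ exists2 x, argminX y x & coupled x y].

(* Optimal values are taken in the extended reals, where the infimum and the
   supremum of any set exist. *)
Definition v_mMI : \bar R :=
  ereal_inf [set ereal_sup [set (f x y)%:E | y in [set y | Y y /\ coupled x y]]
            | x in X].

Definition v_MmI : \bar R :=
  ereal_sup [set ereal_inf [set (f x y)%:E | x in [set x | X x /\ coupled x y]]
            | y in Y].

Definition v_mMO : \bar R :=
  ereal_inf [set ereal_sup [set (f x y)%:E | y in Y] | x in feasible_mMO].

Definition v_MmO : \bar R :=
  ereal_sup [set ereal_inf [set (f x y)%:E | x in X] | y in feasible_MmO].

Definition continuity_assumption : Prop :=
  continuous (fun p : 'cV[R]_n * 'cV[R]_m => f p.1 p.2).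

Definition domain_assumption : Prop :=
  [/\ convex_set X, compact X, convex_set Y, compact Y &
      exists D : R, [/\ 0 < D,
        forall x, X x -> euclidean_norm x <= D &
        forall y, Y y -> euclidean_norm y <= D]].

Definition feasibility_assumption : Prop :=
  [/\ forall x, X x -> exists2 y, Y y & coupled x y,
      forall y, Y y -> exists2 x, X x & coupled x y,
      feasible_mMO !=set0 &
      feasible_MmO !=set0].

Definition standing_assumptions : Prop :=
  [/\ continuity_assumption, domain_assumption & feasibility_assumption].

End Problems.

(* Witness dimensions are successors, so that no relation can be realized only
   by a degenerate instance in which n, m or k is zero. *)
Definition attained (R : realType)
    (rel : forall n m k : nat, problem R n m k -> Prop) : Prop :=
  exists (n m k : nat) (P : problem R n.+1 m.+1 k.+1),
    standing_assumptions P /\ rel _ _ _ P.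

Definition no_definitive_relation (R : realType)
    (u v : forall n m k : nat, problem R n m k -> \bar R) : Prop :=
  [/\ attained (fun n m k (P : problem R n m k) => (u n m k P < v n m k P)%E),
      attained (fun n m k (P : problem R n m k) => u n m k P = v n m k P) &
      attained (fun n m k (P : problem R n m k) => (u n m k P > v n m k P)%E)].

(* Main.v *)
Require Import Defs.
From mathcomp Require Import all_boot all_order all_algebra.
From mathcomp Require Import all_classical all_reals all_analysis.
From mathcomp Require Import lra.

(** The inequalities are order-theoretic.  Passing from (mM-I) to
    (mM-O) shrinks the outer set, since some x become infeasible, and enlarges
    the inner one, since y is no longer restricted by the coupling: both changes
    can only raise a minimum of maxima.  The comparison of (Mm-I) with (Mm-O) is
    the mirror image.  The inner problems of (mM-O) and (Mm-O) are uncoupled, so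
    the weak duality argument applies: for a feasible x and a feasible y,
    inf_X f(., y) <= f(x, y) <= sup_Y f(x, .).

    These inequalities reduce the nine relations of the second part to four
    instances, all with n = m = k = 1 and X = Y = [0, 1].
    - With coupling y <= x and f(x, y) = y, the point x = 0 forces y = 0, so
      v(mM-I) = 0.  Every x minimizes f(., y), so y = 1 is feasible in (Mm-O)
      and v(Mm-O) = 1.  Hence v(mM-I) < v(Mm-O) <= v(Mm-I)
      ([objective_y_lt]).
    - With coupling y <= x and f(x, y) = x, every y maximizes f(x, .), so x = 0
      is feasible in (mM-O) and v(mM-O) = 0, while y = 1 forces x = 1 in
      (Mm-I), so v(mM-O) < v(Mm-I) ([objective_x_lt]).
    - With vacuous coupling and f(x, y) = (x - y)^2, the inner minimum is 0
      whereas the inner maximum is at least 1/4, so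
      v(Mm-O) <= v(Mm-I) < v(mM-I) <= v(mM-O) ([squared_distance_lt]).
    - With f = 0 all four values vanish ([zero_objective_values]). *)

Import Order.TTheory GRing.Theory Num.Theory.
Import numFieldNormedType.Exports.

Set Implicit Arguments.
Unset Strict Implicit.
Unset Printing Implicit Defensive.

Local Open Scope classical_set_scope.
Local Open Scope ring_scope.

(** * Bounds on iterated extrema *)

Section MinimaxBounds.
Context {R : realType} {T U : Type}.
Implicit Types (S : set T) (Q : T -> set U) (f : T -> U -> R) (r : R).

Lemma inf_sup_le S Q f r x : S x -> (forall y, Q x y -> f x y <= r) ->
  (ereal_inf [set ereal_sup [set (f x y)%:E | y in Q x] | x in S] <= r%:E)%E.
Proof.
move=> Sx fr; apply: ge_ereal_inf; exists (ereal_sup [set (f x y)%:E | y in Q x]).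
  by exists x.
by apply: ge_ereal_sup => _ [y Qy <-]; rewrite lee_fin fr.
Qed.

Lemma le_inf_sup S Q f r :
  (forall x, S x -> exists2 y, Q x y & r <= f x y) ->
  (r%:E <= ereal_inf [set ereal_sup [set (f x y)%:E | y in Q x] | x in S])%E.
Proof.
move=> rf; apply: le_ereal_inf_tmp => _ [x Sx <-].
have [y Qy rfy] := rf x Sx.
by apply: le_ereal_sup_tmp; exists (f x y)%:E; [exists y | rewrite lee_fin].
Qed.

Lemma sup_inf_le S Q f r :
  (forall x, S x -> exists2 y, Q x y & f x y <= r) ->
  (ereal_sup [set ereal_inf [set (f x y)%:E | y in Q x] | x in S] <= r%:E)%E.
Proof.
move=> fr; apply: ge_ereal_sup => _ [x Sx <-].
have [y Qy fyr] := fr x Sx.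
by apply: ge_ereal_inf; exists (f x y)%:E; [exists y | rewrite lee_fin].
Qed.

Lemma le_sup_inf S Q f r x : S x -> (forall y, Q x y -> r <= f x y) ->
  (r%:E <= ereal_sup [set ereal_inf [set (f x y)%:E | y in Q x] | x in S])%E.
Proof.
move=> Sx rf; apply: le_ereal_sup_tmp.
exists (ereal_inf [set (f x y)%:E | y in Q x]); first by exists x.
by apply: le_ereal_inf_tmp => _ [y Qy <-]; rewrite lee_fin rf.
Qed.

End MinimaxBounds.

(** * The three inequalities *)

Section Inequalities.
Context {R : realType} {n m k : nat} (P : problem R n m k).

Lemma v_mMI_le_mMO : (v_mMI P <= v_mMO P)%E.
Proof.
apply: le_ereal_inf_tmp => _ [x [Xx _] <-]; apply: ge_ereal_inf.
exists (ereal_sup [set (obj P x y)%:E | y in [set y | Defs.setY P y /\ coupled P x y]]).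
  by exists x.
by apply: ereal_sup_le => _ [y [Yy _] <-]; exists y.
Qed.

Lemma v_MmO_le_MmI : (v_MmO P <= v_MmI P)%E.
Proof.
apply: ge_ereal_sup => _ [y [Yy _] <-]; apply: le_ereal_sup_tmp.
exists (ereal_inf [set (obj P x y)%:E | x in [set x | Defs.setX P x /\ coupled P x y]]).
  by exists y.
by apply: ereal_inf_le_tmp => _ [x [Xx _] <-]; exists x.
Qed.

Lemma v_MmO_le_mMO : (v_MmO P <= v_mMO P)%E.
Proof.
apply: ge_ereal_sup => _ [y [Yy _] <-].
apply: le_ereal_inf_tmp => _ [x [Xx _] <-].
apply: (@le_trans _ _ (obj P x y)%:E).
  by apply: ereal_inf_lbound; exists x.
by apply: ereal_sup_ubound; exists y.
Qed.

End Inequalities.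

(** * Problems over the unit segment *)

Section UnitSegment.
Context {R : realType}.
Implicit Types x : 'cV[R]_1.

Definition unit_segment : set 'cV[R]_1 := [set x | 0 <= x 0 0 <= 1].

Lemma unit_segment_const (t : R) :
  unit_segment (const_mx t) <-> 0 <= t <= 1.
Proof. by rewrite /unit_segment /= mxE. Qed.

Let unit_segment0 : unit_segment (const_mx 0).
Proof. by apply/unit_segment_const; rewrite lexx ler01. Qed.

Let unit_segment1 : unit_segment (const_mx 1).
Proof. by apply/unit_segment_const; rewrite lexx ler01. Qed.

Lemma const_mx_entry x : const_mx (x 0 0) = x.
Proof. by apply/matrixP => i j; rewrite mxE !ord1. Qed.

Lemma convex_unit_segment : convex_set unit_segment.
Proof.
move=> x y l; rewrite !inE /unit_segment /= => /andP[x0 x1] /andP[y0 y1].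
have l0 : 0 <= l%:num by [].
have l1 : l%:num <= 1 by [].
rewrite !mxE /unstable.onem.
apply/andP; split; nra.
Qed.

(** The entrywise balls of the matrix topology make the embedding of the scalars
    an isometry. *)
Lemma continuous_const_mx : continuous (fun t : R => const_mx t : 'cV[R]_1).
Proof.
move=> t; apply/cvg_ballP => e e0.
by apply: filterS (nbhsx_ballx t e e0) => s ts; split=> // i j; rewrite !mxE.
Qed.

(** The segment is the continuous image of the compact interval [0, 1]. *)
Lemma compact_unit_segment : compact unit_segment.
Proof.
have -> : unit_segment = (fun t : R => const_mx t : 'cV[R]_1) @` `[0, 1].
  apply/seteqP; split=> [x x01 | _ [t t01 <-]].
    by exists (x 0 0); [rewrite /= in_itv | rewrite const_mx_entry].
  by apply/unit_segment_const; rewrite /= in_itv in t01.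
apply: continuous_compact; last exact: segment_compact.
exact/continuous_subspaceT/continuous_const_mx.
Qed.

Lemma euclidean_norm_unit_segment x : unit_segment x -> euclidean_norm x <= 1.
Proof.
by move=> /andP[x0 x1]; rewrite /euclidean_norm big_ord1 sqrtr_sqr ger0_norm.
Qed.

(** The single constraint reads a y <= a x.  Two values of a are used:
    a = 1 couples the variables by y <= x, and a = 0 leaves them uncoupled. *)
Definition segment_problem (g : R -> R -> R) (a : R) : problem R 1 1 1 :=
  Problem (fun x y => g (x 0 0) (y 0 0)) unit_segment unit_segment
    (const_mx (- a)) (const_mx a) 0.

Lemma coupled_segmentE (g : R -> R -> R) a x y :
  coupled (segment_problem g a) x y <-> a * y 0 0 <= a * x 0 0.
Proof.
have e : (const_mx (- a) *m x + const_mx a *m y : 'cV[R]_1) 0 0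
    = a * y 0 0 - a * x 0 0.
  by rewrite !mxE !big_ord1 !mxE mulNr addrC.
split=> [/(_ 0) | h i] /=.
  by rewrite e mxE subr_le0.
by rewrite ord1 /= e mxE subr_le0.
Qed.

(** Feasibility comes from the corners of the square: for a >= 0, y = 0 is
    compatible with every x, and x = 1 with every y.  So x = 1 is feasible in
    (mM-O) whichever maximizer of g(1, .) is chosen, y = 0 is feasible in (Mm-O)
    whichever minimizer of g(., 0) is chosen, and such optimizers exist by the
    extreme value theorem. *)
Lemma standing_segment_problem (g : R -> R -> R) (a : R) :
  continuous (fun p : R * R => g p.1 p.2) -> 0 <= a ->
  standing_assumptions (segment_problem g a).
Proof.
move=> gc a0.
have g1 s : continuous (g s).
  move=> t; apply: (@continuous2_cvg R R R R (nbhs t) _ (fun=> s) id g s t).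
  - exact: gc (s, t).
  - exact: cvg_cst.
  - exact: cvg_id.
have g2 t : continuous (g ^~ t).
  move=> s; apply: (@continuous2_cvg R R R R (nbhs s) _ id (fun=> t) g s t).
  - exact: gc (s, t).
  - exact: cvg_id.
  - exact: cvg_cst.
have le0 x : unit_segment x -> coupled (segment_problem g a) x (const_mx 0).
  by case/andP=> x0 _; apply/coupled_segmentE; rewrite mxE ler_wpM2l.
have le1 y : unit_segment y -> coupled (segment_problem g a) (const_mx 1) y.
  by case/andP=> _ y1; apply/coupled_segmentE; rewrite mxE ler_wpM2l.
split.
- move=> p.
  apply: (@continuous2_cvg _ R R R (nbhs p) _
    (fun p => p.1 0 0) (fun p => p.2 0 0) g (p.1 0 0) (p.2 0 0)).
  + exact: gc (_, _).
  + exact: (@cvg_comp _ _ _ fst (fun x : 'cV[R]_1 => x 0 0) (nbhs p) (nbhs p.1) _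
      cvg_fst (@coord_continuous _ _ _ 0 0 p.1)).
  + exact: (@cvg_comp _ _ _ snd (fun x : 'cV[R]_1 => x 0 0) (nbhs p) (nbhs p.2) _
      cvg_snd (@coord_continuous _ _ _ 0 0 p.2)).
- split; [exact: convex_unit_segment | exact: compact_unit_segment
    | exact: convex_unit_segment | exact: compact_unit_segment |].
  by exists 1; split=> [|x|y]; [exact: ltr01 | exact: euclidean_norm_unit_segment..].
- split=> [x Xx | y Yy | |].
  + by exists (const_mx 0); [|exact: le0].
  + by exists (const_mx 1); [|exact: le1].
  + have [s s01 smax] := @EVT_max R (g 1) 0 1 ler01 (continuous_subspaceT (g1 1)).
    exists (const_mx 1); split=> //.
    have Ys : unit_segment (const_mx s) by apply/unit_segment_const; rewrite in_itv in s01.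
    exists (const_mx s); last exact: le1.
    by split=> // y Yy; rewrite /= !mxE smax // in_itv.
  + have [s s01 smin] := @EVT_min R (g ^~ 0) 0 1 ler01 (continuous_subspaceT (g2 0)).
    exists (const_mx 0); split=> //.
    have Xs : unit_segment (const_mx s) by apply/unit_segment_const; rewrite in_itv in s01.
    exists (const_mx s); last exact: le0.
    by split=> // x Xx; rewrite /= !mxE smin // in_itv.
Qed.

(** * Four instances *)

Definition objective_y := segment_problem (fun _ t => t) 1.
Definition objective_x := segment_problem (fun s _ => s) 1.
Definition squared_distance := segment_problem (fun s t => (s - t) ^+ 2) 0.
Definition zero_objective := segment_problem (fun _ _ => 0) 0.

Lemma standing_objective_y : standing_assumptions objective_y.
Proof. by apply: standing_segment_problem ler01 => p; exact: cvg_snd. Qed.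

Lemma standing_objective_x : standing_assumptions objective_x.
Proof. by apply: standing_segment_problem ler01 => p; exact: cvg_fst. Qed.

Lemma standing_squared_distance : standing_assumptions squared_distance.
Proof.
apply: standing_segment_problem (lexx 0) => p.
have d : (q.1 - q.2) @[q --> p] --> p.1 - p.2.
  by apply: cvgB; [exact: cvg_fst | exact: cvg_snd].
by apply: cvgM.
Qed.

Lemma standing_zero_objective : standing_assumptions zero_objective.
Proof. by apply: standing_segment_problem (lexx 0) => p; exact: cvg_cst. Qed.

(** The follower y of (mM-I) is held at 0 by x = 0.  In (Mm-O) the objective
    ignores x, so all x are minimizers and x = 1 certifies that y = 1 is
    feasible. *)
Lemma objective_y_lt : (v_mMI objective_y < v_MmO objective_y)%E.
Proof.
apply: (@le_lt_trans _ _ 0%:E); last apply: (@lt_le_trans _ _ 1%:E).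
- apply: (@inf_sup_le _ _ _ _ _ _ _ (const_mx 0)).
    exact: unit_segment0.
  by move=> y [_ /coupled_segmentE]; rewrite mxE !mul1r.
- by rewrite lte_fin ltr01.
apply: (@le_sup_inf _ _ _ _ _ (fun y x => _) _ (const_mx 1)); last first.
  by move=> x _ /=; rewrite mxE.
split=> //; exists (const_mx 1); first by split.
by apply/coupled_segmentE; rewrite !mxE.
Qed.

(** The mirror image of [objective_y_lt]: y = 0 certifies that x = 0 is feasible
    in (mM-O), and y = 1 forces x = 1 in (Mm-I). *)
Lemma objective_x_lt : (v_mMO objective_x < v_MmI objective_x)%E.
Proof.
apply: (@le_lt_trans _ _ 0%:E); last apply: (@lt_le_trans _ _ 1%:E).
- apply: (@inf_sup_le _ _ _ _ _ _ _ (const_mx 0)).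
    split=> //; exists (const_mx 0); first by split.
    by apply/coupled_segmentE; rewrite !mxE.
  by move=> y _ /=; rewrite mxE.
- by rewrite lte_fin ltr01.
apply: (@le_sup_inf _ _ _ _ _ (fun y x => _) _ (const_mx 1)).
  exact: unit_segment1.
by move=> x [_ /coupled_segmentE]; rewrite mxE !mul1r.
Qed.

(** The classical failure of minimax for an objective that is not concave in y:
    a player who moves second can match x to y, or keep y away from x. *)
Lemma squared_distance_lt : (v_MmI squared_distance < v_mMI squared_distance)%E.
Proof.
apply: (@le_lt_trans _ _ 0%:E); last apply: (@lt_le_trans _ _ (4^-1)%:E).
- apply: (@sup_inf_le _ _ _ _ _ (fun y x => _)) => y Yy.
  exists y; last by rewrite /= subrr expr0n.
  by split=> //; apply/coupled_segmentE.
- by rewrite lte_fin invr_gt0 ltr0n.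
(* One of the two endpoints is at distance at least 1/2 from x. *)
apply: le_inf_sup => x /andP[x0 x1].
have [xle | xgt] := leP (x 0 0) 2^-1.
  exists (const_mx 1); last by rewrite /= mxE; nra.
  by split=> //; apply/coupled_segmentE; rewrite !mul0r.
exists (const_mx 0); last by rewrite /= mxE; nra.
by split=> //; apply/coupled_segmentE; rewrite !mul0r.
Qed.

(** Bounding v(mM-I) and v(Mm-O) from below, v(mM-O) and v(Mm-I) from above,
    suffices: the general inequalities give the other four bounds. *)
Lemma zero_objective_values :
  [/\ v_mMI zero_objective = 0%E, v_MmI zero_objective = 0%E,
      v_mMO zero_objective = 0%E & v_MmO zero_objective = 0%E].
Proof.
have cp x y : coupled zero_objective x y.
  by apply/coupled_segmentE; rewrite !mul0r.
have le_MmO : (0 <= v_MmO zero_objective)%E.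
  apply: (@le_sup_inf _ _ _ _ _ (fun y x => _) _ (const_mx 0)) => //.
  by split=> //; exists (const_mx 0).
have le_mMO : (v_mMO zero_objective <= 0)%E.
  apply: (@inf_sup_le _ _ _ _ _ _ _ (const_mx 0)) => //.
  by split=> //; exists (const_mx 0).
have le_mMI : (0 <= v_mMI zero_objective)%E.
  by apply: le_inf_sup => x Xx; exists (const_mx 0).
have le_MmI : (v_MmI zero_objective <= 0)%E.
  by apply: (@sup_inf_le _ _ _ _ _ (fun y x => _)) => y Yy; exists (const_mx 0).
split; apply/eqP; rewrite eq_le.
- by rewrite le_mMI (le_trans (v_mMI_le_mMO _)).
- by rewrite le_MmI (le_trans le_MmO (v_MmO_le_MmI _)).
- by rewrite le_mMO (le_trans le_mMI (v_mMI_le_mMO _)).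
- by rewrite le_MmO (le_trans (v_MmO_le_MmI _)).
Qed.

End UnitSegment.

Theorem proposition2p4 (R : realType) :
  (forall (n m k : nat) (P : problem R n m k), standing_assumptions P ->
    [/\ (v_mMI P <= v_mMO P)%E,
        (v_MmI P >= v_MmO P)%E &
        (v_mMO P >= v_MmO P)%E]) /\
  [/\ no_definitive_relation (fun n m k (P : problem R n m k) => v_mMI P)
                             (fun n m k (P : problem R n m k) => v_MmI P),
      no_definitive_relation (fun n m k (P : problem R n m k) => v_mMI P)
                             (fun n m k (P : problem R n m k) => v_MmO P) &
      no_definitive_relation (fun n m k (P : problem R n m k) => v_mMO P)
                             (fun n m k (P : problem R n m k) => v_MmI P)].
Proof.
split=> [n m k P _|].
  by split; [exact: v_mMI_le_mMO | exact: v_MmO_le_MmI | exact: v_MmO_le_mMO].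
have [mMI0 MmI0 mMO0 MmO0] := @zero_objective_values R.
split; split.
- exists 0%N, 0%N, 0%N, objective_y; split; first exact: standing_objective_y.
  exact: lt_le_trans objective_y_lt (v_MmO_le_MmI _).
- exists 0%N, 0%N, 0%N, zero_objective; split; first exact: standing_zero_objective.
  by rewrite mMI0 MmI0.
- exists 0%N, 0%N, 0%N, squared_distance; split; first exact: standing_squared_distance.
  exact: squared_distance_lt.
- exists 0%N, 0%N, 0%N, objective_y; split; first exact: standing_objective_y.
  exact: objective_y_lt.
- exists 0%N, 0%N, 0%N, zero_objective; split; first exact: standing_zero_objective.
  by rewrite mMI0 MmO0.
- exists 0%N, 0%N, 0%N, squared_distance; split; first exact: standing_squared_distance.
  exact: le_lt_trans (v_MmO_le_MmI _) squared_distance_lt.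
- exists 0%N, 0%N, 0%N, objective_x; split; first exact: standing_objective_x.
  exact: objective_x_lt.
- exists 0%N, 0%N, 0%N, zero_objective; split; first exact: standing_zero_objective.
  by rewrite mMO0 MmI0.
- exists 0%N, 0%N, 0%N, squared_distance; split; first exact: standing_squared_distance.
  exact: lt_le_trans squared_distance_lt (v_mMI_le_mMO _).
Qed.
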